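(* The functors $\delta^{n}_{n-1},\kappa^{n}_{n-1}:\mathbb{G}_{n-1}\to\mathbb{G}_{n}$ ($n\geqslant 1$) between the $n$-globe categories satisfy, for all $n\geqslant 1$, the coglobular identities $$\delta^{n+1}_{n}\circ\delta^{n}_{n-1}=\kappa^{n+1}_{n}\circ\delta^{n}_{n-1},\qquad \delta^{n+1}_{n}\circ\kappa^{n}_{n-1}=\kappa^{n+1}_{n}\circ\kappa^{n}_{n-1}.$$ Consequently, applying the contravariant functor $[-;\mathbf{Set}]$ to the coglobular complex $(\mathbb{G}_n^{op})_{n\geqslant 0}$ and taking objects yields an $\omega$-graph (the $\omega$-graph of the $\omega$-graphs) $$\cdots\rightrightarrows[\mathbb{G}^{op}_{n};\mathbf{Set}](0)\rightrightarrows[\mathbb{G}^{op}_{n-1};\mathbf{Set}](0)\rightrightarrows\cdots\rightrightarrows[\mathbb{G}^{op}_{1};\mathbf{Set}](0)\rightrightarrows[\mathbb{G}^{op}_{0};\mathbf{Set}](0)$$ whose source map $\sigma^{n}_{n-1}$ is precomposition with $\delta^{n}_{n-1}$ and whose target map $\beta^{n}_{n-1}$ is precomposition with $\kappa^{n}_{n-1}$.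
   Context: An $\omega$-graph (globular set, possibly of large sets) is a sequence of sets $X_n$ ($n\geqslant0$) with maps $s,t:X_{n}\to X_{n-1}$ satisfying $ss=st$ and $ts=tt$. For a category $\mathcal{C}$, $[\mathcal{C}^{op};\mathbf{Set}](0)$ is the (large) set of objects of the presheaf category $[\mathcal{C}^{op};\mathbf{Set}]$. The $n$-globe categories $\mathbb{G}_n$ are defined by generators and relations. $\mathbb{G}_0=\mathbb{G}$ is the globe category: objects $\bar m$ ($m\geqslant0$), generating morphisms $s^{m+1}_m,t^{m+1}_m:\bar m\to\overline{m+1}$, relations $s^{m+2}_{m+1}s^{m+1}_m=t^{m+2}_{m+1}s^{m+1}_m$ and $s^{m+2}_{m+1}t^{m+1}_m=t^{m+2}_{m+1}t^{m+1}_m$. Let $\mathbb{G}_0'$ be a disjoint copy with objects $\bar m'$ and morphisms $s'^{m+1}_m,t'^{m+1}_m$. $\mathbb{G}_1$ is generated by $\mathbb{G}_0$, $\mathbb{G}_0'$ and morphisms $\alpha^m_0:\bar m'\to\bar m$ ($m\geqslant0$), with relations $\alpha^{m+1}_0 s'^{m+1}_m=s^{m+1}_m\alpha^m_0$ and $\alpha^{m+1}_0 t'^{m+1}_m=t^{m+1}_m\alpha^m_0$. For $n\geqslant 2$, $\mathbb{G}_n$ is generated by $\mathbb{G}_0$, $\mathbb{G}_0'$, morphisms $\alpha^m_0,\beta^m_0:\bar m'\to\bar m$ ($m\geqslant0$), morphisms $\alpha_p,\beta_p:\bar p'\to\bar 0$ for $1\leqslant p\leqslant n-2$, and a morphism $\xi_{n-1}:\overline{n-1}'\to\bar0$.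 With the convention $\alpha_0:=\alpha^0_0$, $\beta_0:=\beta^0_0$, the relations are: - $\alpha^{m+1}_0 s'^{m+1}_m=s^{m+1}_m\alpha^m_0$, $\alpha^{m+1}_0 t'^{m+1}_m=t^{m+1}_m\alpha^m_0$, and the same with $\beta$ in place of $\alpha$; - $\alpha_p s'^p_{p-1}=\beta_p s'^p_{p-1}=\alpha_{p-1}$ and $\alpha_p t'^p_{p-1}=\beta_p t'^p_{p-1}=\beta_{p-1}$ for $1\leqslant p\leqslant n-2$; - $\xi_{n-1}s'^{n-1}_{n-2}=\alpha_{n-2}$ and $\xi_{n-1}t'^{n-1}_{n-2}=\beta_{n-2}$. The functors: $\delta^1_0$ sends $\mathbb{G}_0$ identically to $\mathbb{G}_0\subset\mathbb{G}_1$, and $\kappa^1_0$ sends $\mathbb{G}_0$ to the copy $\mathbb{G}_0'\subset\mathbb{G}_1$. For $n\geqslant2$ both $\delta^n_{n-1}$ and $\kappa^n_{n-1}$ are the identity on $\mathbb{G}_0$ and $\mathbb{G}_0'$. The functor $\delta^2_1$ sends $\alpha^m_0\mapsto\alpha^m_0$, and $\kappa^2_1$ sends $\alpha^m_0\mapsto\beta^m_0$. For $n\geqslant3$ both functors fix all $\alpha^m_0,\beta^m_0$ and all $\alpha_p,\beta_p$ ($1\leqslant p\leqslant n-3$), while $\delta^n_{n-1}(\xi_{n-2})=\alpha_{n-2}$ and $\kappa^n_{n-1}(\xi_{n-2})=\beta_{n-2}$. Objects of $[\mathbb{G}_n^{op};\mathbf{Set}]$ are called $(n,\omega)$-graphs.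 *)

(* Defs.v *)
From HB Require Import structures.
From mathcomp Require Import all_boot.
From mathcomp Require Import boolp.

Set Implicit Arguments.
Unset Strict Implicit.
Unset Printing Implicit Defensive.

Local Open Scope quotient_scope.

Declare Scope cat_scope.
Delimit Scope cat_scope with cat.

(* Categories have Leibniz equality on homs.  Since the laws are propositions,
   equality of functors below is the strict one: equal on objects and on
   morphisms. *)
Record category := Category {
  Ob :> Type;
  Hom : Ob -> Ob -> Type;
  idc : forall x, Hom x x;
  comp : forall x y z, Hom y z -> Hom x y -> Hom x z;
  comp1c : forall x y (f : Hom x y), comp (idc y) f = f;
  compc1 : forall x y (f : Hom x y), comp f (idc x) = f;
  compA : forall x y z t (h : Hom z t) (g : Hom y z) (f : Hom x y),
    comp h (comp g f) = comp (comp h g) f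
}.
Arguments Hom {c} x y.
Arguments idc {c} x.

Notation "g \oc f" := (comp g f) (at level 50, left associativity) : cat_scope.
Local Open Scope cat_scope.

Record functor (C D : category) := Functor {
  fob :> C -> D;
  fmap : forall x y, Hom x y -> Hom (fob x) (fob y);
  fmap_id : forall x, fmap (idc x) = idc (fob x);
  fmap_comp : forall x y z (g : Hom y z) (f : Hom x y),
    fmap (g \oc f) = fmap g \oc fmap f
}.
Arguments fmap {C D} _ {x y}.

Lemma compF_id (C D E : category) (G : functor D E) (F : functor C D) x :
  fmap G (fmap F (idc x)) = idc (G (F x)).
Proof. by rewrite !fmap_id. Qed.

Lemma compF_comp (C D E : category) (G : functor D E) (F : functor C D)
    x y z (g : Hom y z) (f : Hom x y) :
  fmap G (fmap F (g \oc f)) = fmap G (fmap F g) \oc fmap G (fmap F f).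
Proof. by rewrite !fmap_comp. Qed.

Definition compF (C D E : category) (G : functor D E) (F : functor C D) :
    functor C E :=
  Functor (fob := fun x => G (F x)) (fmap := fun _ _ f => fmap G (fmap F f))
    (compF_id G F) (@compF_comp _ _ _ G F).

Notation "G \oF F" := (compF G F) (at level 50, left associativity) : cat_scope.

Definition opc (C : category) : category :=
  @Category C (fun x y => @Hom C y x) (@idc C)
    (fun _ _ _ g f => f \oc g)
    (fun _ _ f => compc1 f) (fun _ _ f => comp1c f)
    (fun _ _ _ _ h g f => esym (compA f g h)).

Definition opF (C D : category) (F : functor C D) : functor (opc C) (opc D) :=
  @Functor (opc C) (opc D) F (fun _ _ f => fmap F f) (fmap_id F)
    (fun _ _ _ g f => fmap_comp F f g).

(* The objects of [Sets] live in a universe below the one of [category], so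
   functors into [Sets] form a large type. *)
Definition Sets : category :=
  @Category Type (fun A B => A -> B) (fun _ x => x) (fun _ _ _ g f x => g (f x))
    (fun _ _ _ => erefl) (fun _ _ _ => erefl) (fun _ _ _ _ _ _ _ => erefl).

Record nattrans (C D : category) (F G : functor C D) := NatTrans {
  ncomp :> forall x, Hom (F x) (G x);
  ncompP : forall x y (f : Hom x y),
    ncomp y \oc fmap F f = fmap G f \oc ncomp x
}.

Lemma nattrans_eq (C D : category) (F G : functor C D) (a b : nattrans F G) :
  (forall x, a x = b x) -> a = b.
Proof.
case: a b => [a aP] [b bP] /= eab.
have {}eab : a = b by apply: functional_extensionality_dep.
by rewrite {}eab in aP *; congr NatTrans; apply: Prop_irrelevance.
Qed.

Section FunctorCategory.
Variables C D : category.

Lemma nat_id_subproof (F : functor C D) x y (f : Hom x y) :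
  idc (F y) \oc fmap F f = fmap F f \oc idc (F x).
Proof. by rewrite comp1c compc1. Qed.

Definition nat_id (F : functor C D) : nattrans F F :=
  NatTrans (@nat_id_subproof F).

Lemma nat_comp_subproof (F G H : functor C D) (b : nattrans G H)
    (a : nattrans F G) x y (f : Hom x y) :
  (b y \oc a y) \oc fmap F f = fmap H f \oc (b x \oc a x).
Proof. by rewrite -compA ncompP compA ncompP -compA. Qed.

Definition nat_comp (F G H : functor C D) (b : nattrans G H)
    (a : nattrans F G) : nattrans F H :=
  NatTrans (@nat_comp_subproof F G H b a).

Lemma nat_comp1c F G (a : nattrans F G) : nat_comp (nat_id G) a = a.
Proof. by apply: nattrans_eq => x /=; rewrite comp1c. Qed.

Lemma nat_compc1 F G (a : nattrans F G) : nat_comp a (nat_id F) = a.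
Proof. by apply: nattrans_eq => x /=; rewrite compc1. Qed.

Lemma nat_compA F G H K (c : nattrans H K) (b : nattrans G H)
    (a : nattrans F G) :
  nat_comp c (nat_comp b a) = nat_comp (nat_comp c b) a.
Proof. by apply: nattrans_eq => x /=; rewrite compA. Qed.

Definition functor_cat : category :=
  Category nat_comp1c nat_compc1 nat_compA.

End FunctorCategory.

Notation "[ C ; D ]" := (functor_cat C D) : cat_scope.

Section Precomposition.
Variables (C D E : category) (F : functor C D).

Definition precomp_ob (H : [D; E]) : [C; E] := H \oF F.

Definition precomp_map (H K : [D; E]) (a : nattrans H K) :
    nattrans (precomp_ob H) (precomp_ob K) :=
  @NatTrans _ _ (H \oF F) (K \oF F) (fun x => a (F x))
    (fun _ _ f => ncompP a (fmap F f)).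

Lemma precomp_id (H : [D; E]) : precomp_map (nat_id H) = nat_id (precomp_ob H).
Proof. exact: nattrans_eq. Qed.

Lemma precomp_comp (H K L : [D; E]) (b : nattrans K L) (a : nattrans H K) :
  precomp_map (nat_comp b a) = nat_comp (precomp_map b) (precomp_map a).
Proof. exact: nattrans_eq. Qed.

(* The functor [F; E] : the action on F of the contravariant functor [-; E]. *)
Definition precomp : functor [D; E] [C; E] :=
  @Functor [D; E] [C; E] precomp_ob precomp_map precomp_id precomp_comp.

End Precomposition.

(* Categories presented by generators and relations: words in the generators
   modulo the smallest congruence containing the relations.  A word is read
   in composition order: [wcons g w] is g o w. *)
Section Presentation.
Variables (O : Type) (Q : O -> O -> Type).

Inductive word (x : O) : O -> Type :=
| wnil : word x x
| wcons y z (g : Q y z) (w : word x y) : word x z.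

Fixpoint wcat x y z (v : word y z) : word x y -> word x z :=
  match v in word _ z return word x y -> word x z with
  | wnil => fun w => w
  | wcons _ _ g v' => fun w => wcons g (wcat v' w)
  end.

Lemma wcat1 x y (w : word x y) : wcat w (wnil x) = w.
Proof. by elim: w => //= ? ? ? ? ->. Qed.

Lemma wcatA x y z t (u : word z t) (v : word y z) (w : word x y) :
  wcat u (wcat v w) = wcat (wcat u v) w.
Proof. by elim: u v => //= ? ? ? ? IHu v; rewrite IHu. Qed.

Variable R : forall x y, word x y -> word x y -> Prop.

Inductive wcongr : forall x y, word x y -> word x y -> Prop :=
| wcongr_rel x y (v w : word x y) : R v w -> wcongr v w
| wcongr_refl x y (w : word x y) : wcongr w w
| wcongr_sym x y (v w : word x y) : wcongr v w -> wcongr w v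
| wcongr_trans x y (u v w : word x y) :
    wcongr u v -> wcongr v w -> wcongr u w
| wcongr_cat x y z (v v' : word y z) (w w' : word x y) :
    wcongr v v' -> wcongr w w' -> wcongr (wcat v w) (wcat v' w').

Definition wequiv x y : rel {classic word x y} := fun v w => `[< wcongr v w >].

Lemma wequiv_refl x y : reflexive (@wequiv x y).
Proof. by move=> w; apply/asboolP; apply: wcongr_refl. Qed.

Lemma wequiv_sym x y : symmetric (@wequiv x y).
Proof.
by move=> v w; apply/asboolP/asboolP; apply: wcongr_sym.
Qed.

Lemma wequiv_trans x y : transitive (@wequiv x y).
Proof.
move=> v u w /asboolP uv /asboolP vw; apply/asboolP.
exact: wcongr_trans uv vw.
Qed.

Canonical wequiv_equiv x y :=
  EquivRel (@wequiv x y) (@wequiv_refl x y) (@wequiv_sym x y)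
    (@wequiv_trans x y).

Definition pres_hom x y : Type := {eq_quot @wequiv x y}.

Definition wclass x y (w : word x y) : pres_hom x y :=
  \pi_{eq_quot @wequiv x y} w.

Definition wrepr x y (f : pres_hom x y) : word x y :=
  repr (f : {eq_quot @wequiv x y}).

Lemma wreprK x y (f : pres_hom x y) : wclass (wrepr f) = f.
Proof. exact: reprK. Qed.

Lemma wclassP x y (v w : word x y) : wclass v = wclass w <-> wcongr v w.
Proof.
split=> [/eqmodP/asboolP //|vw].
by apply/eqmodP; apply/asboolP.
Qed.

Lemma wrepr_class x y (w : word x y) : wcongr (wrepr (wclass w)) w.
Proof. by apply/wclassP; rewrite wreprK. Qed.

Definition pres_comp x y z (g : pres_hom y z) (f : pres_hom x y) :
    pres_hom x z :=
  wclass (wcat (wrepr g) (wrepr f)).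

Lemma pres_compE x y z (v : word y z) (w : word x y) :
  pres_comp (wclass v) (wclass w) = wclass (wcat v w).
Proof. by apply/wclassP; apply: wcongr_cat; apply: wrepr_class. Qed.

Lemma pres_comp1c x y (f : pres_hom x y) : pres_comp (wclass (wnil y)) f = f.
Proof. by rewrite -[f]wreprK pres_compE. Qed.

Lemma pres_compc1 x y (f : pres_hom x y) : pres_comp f (wclass (wnil x)) = f.
Proof. by rewrite -[f]wreprK pres_compE wcat1. Qed.

Lemma pres_compA x y z t (h : pres_hom z t) (g : pres_hom y z)
    (f : pres_hom x y) :
  pres_comp h (pres_comp g f) = pres_comp (pres_comp h g) f.
Proof. by rewrite -[h]wreprK -[g]wreprK -[f]wreprK !pres_compE wcatA. Qed.

Definition presented : category :=
  Category pres_comp1c pres_compc1 pres_compA.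

Definition gen x y (g : Q x y) : @Hom presented x y :=
  wclass (wcons g (wnil x)).

(* The functor out of a presented category determined by a map on objects and
   a map on generators that satisfies the relations. *)
Section Extension.
Variables (D : category) (fo : O -> D).
Variable fg : forall x y, Q x y -> Hom (fo x) (fo y).

Fixpoint weval x y (w : word x y) : Hom (fo x) (fo y) :=
  match w in word _ y return Hom (fo x) (fo y) with
  | wnil => idc (fo x)
  | wcons _ _ g w' => fg g \oc weval w'
  end.

Hypothesis fgR : forall x y (v w : word x y), R v w -> weval v = weval w.

Lemma weval_cat x y z (v : word y z) (w : word x y) :
  weval (wcat v w) = weval v \oc weval w.
Proof.
elim: v w => [|? ? g v IHv] w /=; first by rewrite comp1c.
by rewrite IHv compA.
Qed.

Lemma weval_congr x y (v w : word x y) : wcongr v w -> weval v = weval w.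
Proof.
elim=> {x y v w}.
- by move=> x y v w; apply: fgR.
- by [].
- by move=> x y v w _ ->.
- by move=> x y u v w _ -> _ ->.
- by move=> x y z v v' w w' _ ev _ ew; rewrite !weval_cat ev ew.
Qed.

Lemma pres_ext_id (x : presented) : weval (wrepr (idc x)) = idc (fo x).
Proof. by rewrite (weval_congr (wrepr_class (wnil x))). Qed.

Lemma pres_ext_comp (x y z : presented) (g : Hom y z) (f : Hom x y) :
  weval (wrepr (g \oc f)) = weval (wrepr g) \oc weval (wrepr f).
Proof. by rewrite (weval_congr (wrepr_class _)) weval_cat. Qed.

Definition pres_ext : functor presented D :=
  @Functor presented D fo (fun _ _ f => weval (wrepr f))
    pres_ext_id pres_ext_comp.

Lemma pres_ext_gen x y (g : Q x y) : fmap pres_ext (gen g) = fg g.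
Proof. by rewrite /= (weval_congr (wrepr_class _)) /= compc1. Qed.

End Extension.

Lemma gen_rel2 x y z t (g : Q y z) (f : Q x y) (g' : Q t z) (f' : Q x t) :
  R (wcons g (wcons f (wnil x))) (wcons g' (wcons f' (wnil x))) ->
  gen g \oc gen f = gen g' \oc gen f'.
Proof.
by move=> r; rewrite /= !pres_compE; apply/wclassP; apply: wcongr_rel.
Qed.

Lemma gen_rel1 x y z (g : Q y z) (f : Q x y) (h : Q x z) :
  R (wcons g (wcons f (wnil x))) (wcons h (wnil x)) ->
  gen g \oc gen f = gen h.
Proof.
by move=> r; rewrite /= !pres_compE; apply/wclassP; apply: wcongr_rel.
Qed.

End Presentation.

Notation "<[ f ]>w" := (wcons f (wnil _ _)) : cat_scope.
Notation "<[ g , f ]>w" := (wcons g (wcons f (wnil _ _))) : cat_scope.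

(* The globe category G_0; the object m-bar is the number m. *)
Inductive gen0 : nat -> nat -> Type :=
| S0 m : gen0 m m.+1
| T0 m : gen0 m m.+1.

Inductive rel0 : forall x y, word gen0 x y -> word gen0 x y -> Prop :=
| rel0_s m : rel0 <[ S0 m.+1, S0 m ]>w <[ T0 m.+1, S0 m ]>w
| rel0_t m : rel0 <[ S0 m.+1, T0 m ]>w <[ T0 m.+1, T0 m ]>w.

Definition G0 : category := presented rel0.

(* The objects of G_n for n >= 1: m-bar and m-bar'. *)
Inductive globe := Bar of nat | Bar' of nat.

Inductive gen1 : globe -> globe -> Type :=
| S1 m : gen1 (Bar m) (Bar m.+1)
| T1 m : gen1 (Bar m) (Bar m.+1)
| S1' m : gen1 (Bar' m) (Bar' m.+1)
| T1' m : gen1 (Bar' m) (Bar' m.+1)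
| A1 m : gen1 (Bar' m) (Bar m).

Inductive rel1 : forall x y, word gen1 x y -> word gen1 x y -> Prop :=
| rel1_s m : rel1 <[ S1 m.+1, S1 m ]>w <[ T1 m.+1, S1 m ]>w
| rel1_t m : rel1 <[ S1 m.+1, T1 m ]>w <[ T1 m.+1, T1 m ]>w
| rel1_s' m : rel1 <[ S1' m.+1, S1' m ]>w <[ T1' m.+1, S1' m ]>w
| rel1_t' m : rel1 <[ S1' m.+1, T1' m ]>w <[ T1' m.+1, T1' m ]>w
| rel1_as m : rel1 <[ A1 m.+1, S1' m ]>w <[ S1 m, A1 m ]>w
| rel1_at m : rel1 <[ A1 m.+1, T1' m ]>w <[ T1 m, A1 m ]>w.

Definition G1 : category := presented rel1.

(* Generators of G_(k+2).  [Ga m] and [Gb m] are alpha^m_0 and beta^m_0;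
   [Gap q _] and [Gbp q _] are alpha_(q+1) and beta_(q+1), which exist for
   1 <= q+1 <= k; [Gxi] is xi_(k+1). *)
Inductive gen2 (k : nat) : globe -> globe -> Type :=
| Gs m : gen2 k (Bar m) (Bar m.+1)
| Gt m : gen2 k (Bar m) (Bar m.+1)
| Gs' m : gen2 k (Bar' m) (Bar' m.+1)
| Gt' m : gen2 k (Bar' m) (Bar' m.+1)
| Ga m : gen2 k (Bar' m) (Bar m)
| Gb m : gen2 k (Bar' m) (Bar m)
| Gap q : q < k -> gen2 k (Bar' q.+1) (Bar 0)
| Gbp q : q < k -> gen2 k (Bar' q.+1) (Bar 0)
| Gxi : gen2 k (Bar' k.+1) (Bar 0).
Arguments Gs {k} m.
Arguments Gt {k} m.
Arguments Gs' {k} m.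
Arguments Gt' {k} m.
Arguments Ga {k} m.
Arguments Gb {k} m.
Arguments Gap {k} q _.
Arguments Gbp {k} q _.
Arguments Gxi {k}.

(* alpha_p and beta_p for 0 <= p <= k, with alpha_0 = alpha^0_0 and
   beta_0 = beta^0_0. *)
Definition alpha k p : p <= k -> gen2 k (Bar' p) (Bar 0) :=
  if p is q.+1 then fun h => Gap q h else fun _ => Ga 0.

Definition beta k p : p <= k -> gen2 k (Bar' p) (Bar 0) :=
  if p is q.+1 then fun h => Gbp q h else fun _ => Gb 0.

Inductive rel2 (k : nat) :
    forall x y, word (gen2 k) x y -> word (gen2 k) x y -> Prop :=
| rel2_s m : rel2 <[ Gs m.+1, Gs m ]>w <[ Gt m.+1, Gs m ]>w
| rel2_t m : rel2 <[ Gs m.+1, Gt m ]>w <[ Gt m.+1, Gt m ]>w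
| rel2_s' m : rel2 <[ Gs' m.+1, Gs' m ]>w <[ Gt' m.+1, Gs' m ]>w
| rel2_t' m : rel2 <[ Gs' m.+1, Gt' m ]>w <[ Gt' m.+1, Gt' m ]>w
| rel2_as m : rel2 <[ Ga m.+1, Gs' m ]>w <[ Gs m, Ga m ]>w
| rel2_at m : rel2 <[ Ga m.+1, Gt' m ]>w <[ Gt m, Ga m ]>w
| rel2_bs m : rel2 <[ Gb m.+1, Gs' m ]>w <[ Gs m, Gb m ]>w
| rel2_bt m : rel2 <[ Gb m.+1, Gt' m ]>w <[ Gt m, Gb m ]>w
| rel2_aps p (h : p.+1 <= k) :
    rel2 <[ alpha h, Gs' p ]>w <[ alpha (ltnW h) ]>w
| rel2_bps p (h : p.+1 <= k) :
    rel2 <[ beta h, Gs' p ]>w <[ alpha (ltnW h) ]>w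
| rel2_apt p (h : p.+1 <= k) :
    rel2 <[ alpha h, Gt' p ]>w <[ beta (ltnW h) ]>w
| rel2_bpt p (h : p.+1 <= k) :
    rel2 <[ beta h, Gt' p ]>w <[ beta (ltnW h) ]>w
| rel2_xs : rel2 <[ Gxi, Gs' k ]>w <[ alpha (leqnn k) ]>w
| rel2_xt : rel2 <[ Gxi, Gt' k ]>w <[ beta (leqnn k) ]>w.

Definition G2 (k : nat) : category := presented (@rel2 k).

Definition G (n : nat) : category :=
  match n with 0 => G0 | 1 => G1 | k.+2 => G2 k end.

Definition delta0_gen x y (g : gen0 x y) : @Hom G1 (Bar x) (Bar y) :=
  match g in gen0 x y return @Hom G1 (Bar x) (Bar y) with
  | S0 m => gen rel1 (S1 m)
  | T0 m => gen rel1 (T1 m)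
  end.

Definition kappa0_gen x y (g : gen0 x y) : @Hom G1 (Bar' x) (Bar' y) :=
  match g in gen0 x y return @Hom G1 (Bar' x) (Bar' y) with
  | S0 m => gen rel1 (S1' m)
  | T0 m => gen rel1 (T1' m)
  end.

Definition delta1_gen x y (g : gen1 x y) : @Hom (G2 0) x y :=
  match g in gen1 x y return @Hom (G2 0) x y with
  | S1 m => gen (@rel2 0) (Gs m)
  | T1 m => gen (@rel2 0) (Gt m)
  | S1' m => gen (@rel2 0) (Gs' m)
  | T1' m => gen (@rel2 0) (Gt' m)
  | A1 m => gen (@rel2 0) (Ga m)
  end.

Definition kappa1_gen x y (g : gen1 x y) : @Hom (G2 0) x y :=
  match g in gen1 x y return @Hom (G2 0) x y with
  | S1 m => gen (@rel2 0) (Gs m)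
  | T1 m => gen (@rel2 0) (Gt m)
  | S1' m => gen (@rel2 0) (Gs' m)
  | T1' m => gen (@rel2 0) (Gt' m)
  | A1 m => gen (@rel2 0) (Gb m)
  end.

Definition delta2_gen k x y (g : gen2 k x y) : @Hom (G2 k.+1) x y :=
  match g in gen2 _ x y return @Hom (G2 k.+1) x y with
  | Gs m => gen (@rel2 k.+1) (Gs m)
  | Gt m => gen (@rel2 k.+1) (Gt m)
  | Gs' m => gen (@rel2 k.+1) (Gs' m)
  | Gt' m => gen (@rel2 k.+1) (Gt' m)
  | Ga m => gen (@rel2 k.+1) (Ga m)
  | Gb m => gen (@rel2 k.+1) (Gb m)
  | Gap q h => gen (@rel2 k.+1) (Gap q (leqW h))
  | Gbp q h => gen (@rel2 k.+1) (Gbp q (leqW h))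
  | Gxi => gen (@rel2 k.+1) (Gap k (ltnSn k))
  end.

Definition kappa2_gen k x y (g : gen2 k x y) : @Hom (G2 k.+1) x y :=
  match g in gen2 _ x y return @Hom (G2 k.+1) x y with
  | Gs m => gen (@rel2 k.+1) (Gs m)
  | Gt m => gen (@rel2 k.+1) (Gt m)
  | Gs' m => gen (@rel2 k.+1) (Gs' m)
  | Gt' m => gen (@rel2 k.+1) (Gt' m)
  | Ga m => gen (@rel2 k.+1) (Ga m)
  | Gb m => gen (@rel2 k.+1) (Gb m)
  | Gap q h => gen (@rel2 k.+1) (Gap q (leqW h))
  | Gbp q h => gen (@rel2 k.+1) (Gbp q (leqW h))
  | Gxi => gen (@rel2 k.+1) (Gbp k (ltnSn k))
  end.

Lemma delta0_rel x y (v w : word gen0 x y) :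
  rel0 v w -> weval delta0_gen v = weval delta0_gen w.
Proof. by case=> m; cbn [weval delta0_gen]; rewrite !compc1; apply: gen_rel2; constructor. Qed.

Lemma kappa0_rel x y (v w : word gen0 x y) :
  rel0 v w -> weval kappa0_gen v = weval kappa0_gen w.
Proof. by case=> m; cbn [weval kappa0_gen]; rewrite !compc1; apply: gen_rel2; constructor. Qed.

Lemma delta1_rel x y (v w : word gen1 x y) :
  rel1 v w -> weval delta1_gen v = weval delta1_gen w.
Proof. by case=> m; cbn [weval delta1_gen]; rewrite !compc1; apply: gen_rel2; constructor. Qed.

Lemma kappa1_rel x y (v w : word gen1 x y) :
  rel1 v w -> weval kappa1_gen v = weval kappa1_gen w.
Proof. by case=> m; cbn [weval kappa1_gen]; rewrite !compc1; apply: gen_rel2; constructor. Qed.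

Lemma delta2_alpha k p (h : p <= k) :
  delta2_gen (alpha h) = gen (@rel2 k.+1) (alpha (leqW h)).
Proof. by case: p h => //= p h; congr (gen _ (Gap _ _)); apply: bool_irrelevance. Qed.

Lemma delta2_beta k p (h : p <= k) :
  delta2_gen (beta h) = gen (@rel2 k.+1) (beta (leqW h)).
Proof. by case: p h => //= p h; congr (gen _ (Gbp _ _)); apply: bool_irrelevance. Qed.

Lemma kappa2_alpha k p (h : p <= k) :
  kappa2_gen (alpha h) = gen (@rel2 k.+1) (alpha (leqW h)).
Proof. by case: p h => //= p h; congr (gen _ (Gap _ _)); apply: bool_irrelevance. Qed.

Lemma kappa2_beta k p (h : p <= k) :
  kappa2_gen (beta h) = gen (@rel2 k.+1) (beta (leqW h)).
Proof. by case: p h => //= p h; congr (gen _ (Gbp _ _)); apply: bool_irrelevance. Qed.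

(* The relations of G_(k+2) on alpha_p, beta_p, for arbitrary bound proofs. *)
Lemma rel2_low k p (h : p.+1 <= k) (h' : p <= k) :
  [/\ rel2 <[ alpha h, Gs' p ]>w <[ alpha h' ]>w,
      rel2 <[ beta h, Gs' p ]>w <[ alpha h' ]>w,
      rel2 <[ alpha h, Gt' p ]>w <[ beta h' ]>w &
      rel2 <[ beta h, Gt' p ]>w <[ beta h' ]>w].
Proof. by rewrite (bool_irrelevance h' (ltnW h)); split; constructor. Qed.

Lemma delta2_rel k x y (v w : word (gen2 k) x y) :
  rel2 v w -> weval (@delta2_gen k) v = weval (@delta2_gen k) w.
Proof.
case; try by move=> m; cbn [weval delta2_gen]; rewrite !compc1; apply: gen_rel2; constructor.
1-4: move=> p h; cbn [weval]; rewrite ?delta2_alpha ?delta2_beta !compc1;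
  by apply: gen_rel1; case: (rel2_low (leqW h) (leqW (ltnW h))).
all: cbn [weval]; rewrite ?delta2_alpha ?delta2_beta !compc1; apply: gen_rel1.
all: by case: (rel2_low (ltnSn k) (leqW (leqnn k))).
Qed.

Lemma kappa2_rel k x y (v w : word (gen2 k) x y) :
  rel2 v w -> weval (@kappa2_gen k) v = weval (@kappa2_gen k) w.
Proof.
case; try by move=> m; cbn [weval kappa2_gen]; rewrite !compc1; apply: gen_rel2; constructor.
1-4: move=> p h; cbn [weval]; rewrite ?kappa2_alpha ?kappa2_beta !compc1;
  by apply: gen_rel1; case: (rel2_low (leqW h) (leqW (ltnW h))).
all: cbn [weval]; rewrite ?kappa2_alpha ?kappa2_beta !compc1; apply: gen_rel1.
all: by case: (rel2_low (ltnSn k) (leqW (leqnn k))).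
Qed.

(* [delta n] is delta^(n+1)_n, and [kappa n] is kappa^(n+1)_n. *)
Definition delta (n : nat) : functor (G n) (G n.+1) :=
  match n return functor (G n) (G n.+1) with
  | 0 => @pres_ext _ _ rel0 G1 Bar delta0_gen delta0_rel
  | 1 => @pres_ext _ _ rel1 (G2 0) id delta1_gen delta1_rel
  | k.+2 => @pres_ext _ _ (@rel2 k) (G2 k.+1) id (@delta2_gen k) (@delta2_rel k)
  end.

Definition kappa (n : nat) : functor (G n) (G n.+1) :=
  match n return functor (G n) (G n.+1) with
  | 0 => @pres_ext _ _ rel0 G1 Bar' kappa0_gen kappa0_rel
  | 1 => @pres_ext _ _ rel1 (G2 0) id kappa1_gen kappa1_rel
  | k.+2 => @pres_ext _ _ (@rel2 k) (G2 k.+1) id (@kappa2_gen k) (@kappa2_rel k)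
  end.

(* [s n], [t n] are the source and target maps X_(n+1) -> X_n. *)
Definition is_omega_graph (X : nat -> Type) (s t : forall n, X n.+1 -> X n) :
    Prop :=
  forall n (x : X n.+2),
    s n (s n.+1 x) = s n (t n.+1 x) /\ t n (s n.+1 x) = t n (t n.+1 x).

(* The (n, omega)-graphs, i.e. the objects of [G_n^op; Set]. *)
Definition nw_graph (n : nat) : Type := Ob [opc (G n); Sets].

Definition sigma (n : nat) : nw_graph n.+1 -> nw_graph n :=
  fob (precomp Sets (opF (delta n))).

Definition tau (n : nat) : nw_graph n.+1 -> nw_graph n :=
  fob (precomp Sets (opF (kappa n))).

(* Main.v *)
Require Import Defs.
From mathcomp Require Import all_boot.
From mathcomp Require Import boolp.

Set Implicit Arguments.
Unset Strict Implicit.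
Unset Printing Implicit Defensive.

Local Open Scope cat_scope.

(** A functor out of a presented category is determined by its values on the
    generators ([presented_functor_eq]), so each coglobular identity is checked
    one generator at a time ([delta_kappa_cofork]).  The functors
    [delta n.+1] and [kappa n.+1] differ on a single kind of generator of
    [G n.+1], its top one: the family [A1] when [n = 0], and [Gxi] when
    [n > 0].  Neither [delta n] nor [kappa n] hits that generator: when [n > 0]
    they send the top generators of [G n] to some [Ga], [Gb], [Gap] or [Gbp],
    and [delta 0], [kappa 0] reach only the two copies of the globe category.
    On all these images [delta n.+1] and [kappa n.+1] agree.

    The globular identities follow because precomposition is contravariantly
    functorial: precomposing twice is precomposing with the composite. *)

(** The two functors share the object map [fo] definitionally, which spares
    transporting morphisms along an equality of objects; the composites
    compared below all have this form. *)
Lemma functor_eq (C D : category) (fo : C -> D)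
    (fm fm' : forall x y : C, Hom x y -> Hom (fo x) (fo y)) fi fc fi' fc' :
  (forall x y (f : Hom x y), fm x y f = fm' x y f) ->
  @Functor C D fo fm fi fc = @Functor C D fo fm' fi' fc'.
Proof.
move=> efm.
have {}efm : fm = fm'.
  by apply: functional_extensionality_dep => x;
     apply: functional_extensionality_dep => y;
     apply: functional_extensionality_dep => f; apply: efm.
by rewrite {}efm in fi fc *; congr Functor; apply: Prop_irrelevance.
Qed.

(** Every morphism of a presented category is a composite of generators. *)
Lemma presented_functor_eq (O : Type) (Q : O -> O -> Type)
    (R : forall x y, word Q x y -> word Q x y -> Prop) (D : category)
    (fo : presented R -> D)
    (fm fm' : forall x y : presented R, Hom x y -> Hom (fo x) (fo y))
    fi fc fi' fc' :
  (forall x y (g : Q x y), fm x y (gen R g) = fm' x y (gen R g)) ->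
  @Functor (presented R) D fo fm fi fc = @Functor (presented R) D fo fm' fi' fc'.
Proof.
move=> egen; apply: functor_eq => x y f.
rewrite -[f](@wreprK _ _ R); elim: (wrepr f) => [|{f}y' z g w IHw].
  exact: etrans (fi x) (esym (fi' x)).
have -> : wclass R (wcons g w) = gen R g \oc (wclass R w : @Hom (presented R) x y').
  by rewrite /= pres_compE.
by rewrite fc fc' egen IHw.
Qed.

Lemma delta_kappa_cofork (n : nat) :
  delta n.+1 \oF delta n = kappa n.+1 \oF delta n /\
  delta n.+1 \oF kappa n = kappa n.+1 \oF kappa n.
Proof.
by case: n => [|[|k]]; split; apply: presented_functor_eq => x y g;
   rewrite pres_ext_gen; case: g => *; rewrite [LHS]pres_ext_gen [RHS]pres_ext_gen.
Qed.

Lemma precomp_ob_compF (A B C E : category) (F : functor A B)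
    (K : functor B C) (H : functor (opc C) E) :
  precomp_ob (opF F) (precomp_ob (opF K) H) = precomp_ob (opF (K \oF F)) H.
Proof. exact: functor_eq. Qed.

Theorem mainTheorem1 :
  (forall n : nat,
     delta n.+1 \oF delta n = kappa n.+1 \oF delta n /\
     delta n.+1 \oF kappa n = kappa n.+1 \oF kappa n) /\
  is_omega_graph sigma tau.
Proof.
split=> [|n X]; first exact: delta_kappa_cofork.
have [eqd eqk] := delta_kappa_cofork n.
by rewrite /sigma /tau /= !precomp_ob_compF eqd eqk.
Qed.
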